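(* Let $X$ and $Y$ be the hypersurfaces in $\mathbb{A}^3_{\mathbb{C}}=\operatorname{Spec}\mathbb{C}[x,y,z]$ defined by $xz-y^2+1=0$ and $x^2z-y^2+1=0$, respectively. Then $X\not\simeq Y$, but $X_m\simeq Y_m$ for every $m\in\mathbb{N}\cup\{\infty\}$, where $X_m$ and $Y_m$ denote the $m$-jet schemes of $X$ and $Y$ over $\mathbb{C}$.
   Context: Isomorphisms are isomorphisms of schemes over $\mathbb{C}$. For a scheme $X$ of finite type over a field $k$ and $m\in\mathbb{N}$, the $m$-jet scheme $X_m$ is the $k$-scheme representing the functor $Z\mapsto \operatorname{Hom}_k(Z\times_{\operatorname{Spec} k}\operatorname{Spec} k[t]/(t^{m+1}),X)$ on $k$-schemes; its $K$-valued points, for a field extension $K\supset k$, are the $m$-jets $\operatorname{Spec}K[t]/(t^{m+1})\to X$. For $m'<m$ in $\mathbb{N}$, reduction modulo $t^{m'+1}$ gives the truncation morphism $X_m\to X_{m'}$, and $X_\infty=\varprojlim_m X_m$ is the projective limit (the arc space); its $K$-valued points are the arcs $\operatorname{Spec}K[[t]]\to X$. *)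

(* Defs.v *)
(* Schemes over a field k are given by their functors of points, i.e., as
   functors from commutative k-algebras to sets: by the Yoneda lemma and
   gluing, this embeds k-schemes fully faithfully, so an isomorphism of
   k-schemes is a natural isomorphism.  In this language the m-jet scheme is
   the functor R |-> X(R[t]/(t^(m+1))) it is defined to represent.
     comAlgType consists of nonzero algebras.  Nothing is lost: every scheme
   has exactly one point over the zero algebra. *)
From HB Require Import structures.
From mathcomp Require Import all_boot all_order all_algebra.
From mathcomp Require Import boolp reals complex mpoly.

Set Implicit Arguments.
Unset Strict Implicit.
Unset Printing Implicit Defensive.

Import GRing.Theory.
Local Open Scope ring_scope.

Record kfunctor (k : fieldType) := KFunctor {
  points :> comAlgType k -> Type;
  fmap : forall R S : comAlgType k, {lrmorphism R -> S} -> points R -> points S;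
  fmap_id : forall (R : comAlgType k) (phi : {lrmorphism R -> R}),
    phi =1 id -> fmap phi =1 id;
  fmap_comp : forall (R S T : comAlgType k) (phi : {lrmorphism R -> S})
      (psi : {lrmorphism S -> T}) (chi : {lrmorphism R -> T}),
    chi =1 psi \o phi -> fmap chi =1 fmap psi \o fmap phi
}.

Record kmorphism (k : fieldType) (X Y : kfunctor k) := Morphism {
  component :> forall R : comAlgType k, X R -> Y R;
  naturality : forall (R S : comAlgType k) (phi : {lrmorphism R -> S}) (p : X R),
    component (fmap phi p) = fmap phi (component p)
}.

Definition isomorphic (k : fieldType) (X Y : kfunctor k) : Prop :=
  exists (f : kmorphism X Y) (g : kmorphism Y X),
    forall R : comAlgType k, cancel (@component k X Y f R) (g R) /\
                             cancel (@component k Y X g R) (f R).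

Section Hypersurface.
Variables (k : fieldType) (n : nat) (f : {mpoly k[n]}).

Definition hyp_points (R : comAlgType k) : Type :=
  {v : {ffun 'I_n -> R} | mmap (in_alg R) v f == 0}.

Fact hyp_fmap_subproof (R S : comAlgType k) (phi : {lrmorphism R -> S})
    (p : hyp_points R) :
  mmap (in_alg S) [ffun i => phi (val p i)] f == 0.
Proof.
case: p => v /= /eqP /(congr1 phi); rewrite raddf0 => <-.
rewrite /mmap raddf_sum; apply/eqP/eq_bigr => m _ /=.
rewrite rmorphM /= rmorph_alg /mmap1 rmorph_prod; congr (_ * _).
by apply: eq_bigr => i _; rewrite ffunE rmorphXn.
Qed.

Definition hyp_fmap (R S : comAlgType k) (phi : {lrmorphism R -> S})
  (p : hyp_points R) : hyp_points S :=
  exist _ [ffun i => phi (val p i)] (hyp_fmap_subproof phi p).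

Fact hyp_fmap_id (R : comAlgType k) (phi : {lrmorphism R -> R}) :
  phi =1 id -> hyp_fmap phi =1 id.
Proof. by move=> e p; apply/val_inj/ffunP => i; rewrite /= ffunE e. Qed.

Fact hyp_fmap_comp (R S T : comAlgType k) (phi : {lrmorphism R -> S})
    (psi : {lrmorphism S -> T}) (chi : {lrmorphism R -> T}) :
  chi =1 psi \o phi -> hyp_fmap chi =1 hyp_fmap psi \o hyp_fmap phi.
Proof. by move=> e p; apply/val_inj/ffunP => i; rewrite /= !ffunE e. Qed.

Definition hypersurface : kfunctor k := KFunctor hyp_fmap_id hyp_fmap_comp.

End Hypersurface.

(* The alias carries the k-algebra structure inherited from R, whereas
   {poly %/ _} is only an R-algebra. *)
Definition truncpoly (k : fieldType) (R : comAlgType k) (m : nat) : Type :=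
  {poly %/ ('X^(m.+1) : {poly R})}.

Section TruncPoly.
Variables (k : fieldType) (R : comAlgType k) (m : nat).
Local Notation T := (truncpoly R m).

HB.instance Definition _ := GRing.ComNzRing.on T.

Definition truncpoly_scale (a : k) (p : T) : T :=
  (a%:A : R) *: (p : {poly %/ ('X^(m.+1) : {poly R})}).

Fact truncpoly_scaleA a b p :
  truncpoly_scale a (truncpoly_scale b p) = truncpoly_scale (a * b) p.
Proof. by rewrite /truncpoly_scale scalerA mulr_algl scalerA. Qed.

Fact truncpoly_scale1 : left_id 1 truncpoly_scale.
Proof. by move=> p; rewrite /truncpoly_scale scale1r scale1r. Qed.

Fact truncpoly_scaleDr : right_distributive truncpoly_scale +%R.
Proof. by move=> a p q; rewrite /truncpoly_scale scalerDr. Qed.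

Fact truncpoly_scaleDl p : {morph truncpoly_scale^~ p : a b / a + b}.
Proof. by move=> a b; rewrite /truncpoly_scale scalerDl scalerDl. Qed.

HB.instance Definition _ := GRing.Zmodule_isLmodule.Build k T
  truncpoly_scaleA truncpoly_scale1 truncpoly_scaleDr truncpoly_scaleDl.

Fact truncpoly_scaleAl (a : k) (p q : T) : a *: (p * q) = a *: p * q.
Proof. exact: (@scalerAl R {poly %/ ('X^(m.+1) : {poly R})}). Qed.

HB.instance Definition _ := GRing.Lmodule_isLalgebra.Build k T truncpoly_scaleAl.
HB.instance Definition _ := GRing.Lalgebra_isComAlgebra.Build k T.

Lemma truncpolyP (p q : T) :
  (forall i, (i <= m)%N -> (p : {poly R})`_i = (q : {poly R})`_i) <-> p = q.
Proof.
split=> [e|->//]; apply/val_inj/polyP => i.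
have [/e//|lt] := leqP i m.
have le (r : T) : (size (r : {poly R}) <= i)%N.
  apply: leq_trans lt; rewrite -ltnS; apply: leq_trans (size_mk_monic r) _.
  by rewrite mk_monic_Xn size_polyXn.
by rewrite !nth_default ?le.
Qed.

Lemma coef_in_truncpoly (p : {poly R}) i : (i <= m)%N ->
  (in_qpoly ('X^(m.+1) : {poly R}) p : {poly R})`_i = p`_i.
Proof.
move=> le; rewrite /= mk_monic_Xn /= -{1}(poly_take_drop m.+1 p) addrC.
rewrite Pdiv.RingMonic.rmodp_addl_mul_small ?monicXn //.
  by rewrite coef_take_poly ltnS le.
by rewrite size_polyXn ltnS size_take_poly.
Qed.

Lemma coef_truncpolyM (p q : T) i : (i <= m)%N ->
  ((p * q : T) : {poly R})`_i = ((p : {poly R}) * (q : {poly R}))`_i.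
Proof. by move=> le; rewrite coef_in_truncpoly. Qed.

End TruncPoly.

Section TruncPolyMap.
Variables (k : fieldType) (R S : comAlgType k) (phi : {lrmorphism R -> S}).
Variable m : nat.

Definition truncpoly_map (p : truncpoly R m) : truncpoly S m :=
  in_qpoly ('X^(m.+1) : {poly S}) (map_poly phi (p : {poly R})).

Lemma coef_truncpoly_map p i : (i <= m)%N ->
  (truncpoly_map p : {poly S})`_i = phi (p : {poly R})`_i.
Proof. by move=> le; rewrite coef_in_truncpoly // coef_map. Qed.

Fact truncpoly_map_linear : linear truncpoly_map.
Proof.
move=> a p q; apply/truncpolyP => i le.
rewrite coef_truncpoly_map // !coefD !coefZ !coef_truncpoly_map //.
by rewrite !mulr_algl linearP.
Qed.

Fact truncpoly_map_monoid_morphism : monoid_morphism truncpoly_map.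
Proof.
split=> [|p q]; apply/truncpolyP => i le.
  by rewrite coef_truncpoly_map // !coef1 rmorph_nat.
rewrite coef_truncpoly_map // !coef_truncpolyM // -coef_map rmorphM !coefM.
apply: eq_bigr => j _; rewrite !coef_map !coef_truncpoly_map //.
  exact: leq_trans (leq_subr _ _) le.
by apply: leq_trans le; rewrite -ltnS.
Qed.

HB.instance Definition _ := GRing.isLinear.Build k
  (truncpoly R m) (truncpoly S m) _ truncpoly_map truncpoly_map_linear.
HB.instance Definition _ := GRing.isMonoidMorphism.Build
  (truncpoly R m) (truncpoly S m) truncpoly_map truncpoly_map_monoid_morphism.

End TruncPolyMap.

Section Truncation.
Variables (k : fieldType) (R : comAlgType k) (m' m : nat) (lt : (m' < m)%N).

(* The unused proof argument lets the morphism instances below mention it. *)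
Definition truncpoly_trunc (_ : (m' < m)%N) (p : truncpoly R m) : truncpoly R m' :=
  in_qpoly ('X^(m'.+1) : {poly R}) (p : {poly R}).
Local Notation tr := (truncpoly_trunc lt).

Lemma coef_truncpoly_trunc p i : (i <= m')%N ->
  (tr p : {poly R})`_i = (p : {poly R})`_i.
Proof. exact: coef_in_truncpoly. Qed.

Fact truncpoly_trunc_linear : linear tr.
Proof.
move=> a p q; apply/truncpolyP => i le.
by rewrite coef_truncpoly_trunc // !coefD !coefZ !coef_truncpoly_trunc.
Qed.

Fact truncpoly_trunc_monoid_morphism : monoid_morphism tr.
Proof.
split=> [|p q]; apply/truncpolyP => i le; first by rewrite coef_truncpoly_trunc.
rewrite coef_truncpoly_trunc // !coef_truncpolyM ?(leq_trans le (ltnW lt)) //.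
rewrite !coefM; apply: eq_bigr => j _; rewrite !coef_truncpoly_trunc //.
  exact: leq_trans (leq_subr _ _) le.
by apply: leq_trans le; rewrite -ltnS.
Qed.

HB.instance Definition _ := GRing.isLinear.Build k
  (truncpoly R m) (truncpoly R m') _ tr truncpoly_trunc_linear.
HB.instance Definition _ := GRing.isMonoidMorphism.Build
  (truncpoly R m) (truncpoly R m') tr truncpoly_trunc_monoid_morphism.

End Truncation.

Section Jets.
Variables (k : fieldType) (X : kfunctor k).

Definition jet_fmap (m : nat) (R S : comAlgType k) (phi : {lrmorphism R -> S}) :
  X (truncpoly R m) -> X (truncpoly S m) := fmap (truncpoly_map phi (m := m)).

Fact jet_fmap_id m (R : comAlgType k) (phi : {lrmorphism R -> R}) :
  phi =1 id -> jet_fmap (m := m) phi =1 id.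
Proof.
move=> e; apply: fmap_id => p; apply/truncpolyP => i le.
by rewrite coef_truncpoly_map // e.
Qed.

Fact jet_fmap_comp m (R S T : comAlgType k) (phi : {lrmorphism R -> S})
    (psi : {lrmorphism S -> T}) (chi : {lrmorphism R -> T}) :
  chi =1 psi \o phi ->
  jet_fmap (m := m) chi =1 jet_fmap (m := m) psi \o jet_fmap (m := m) phi.
Proof.
move=> e; apply: fmap_comp => p; apply/truncpolyP => i le.
by rewrite /comp !coef_truncpoly_map // e.
Qed.

Definition jet_scheme (m : nat) : kfunctor k :=
  KFunctor (@jet_fmap_id m) (@jet_fmap_comp m).

Definition jet_trunc_component (m' m : nat) (lt : (m' < m)%N) (R : comAlgType k) :
  jet_scheme m R -> jet_scheme m' R := fmap (truncpoly_trunc (R := R) lt).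

Fact jet_trunc_natural (m' m : nat) (lt : (m' < m)%N) (R S : comAlgType k)
    (phi : {lrmorphism R -> S}) (p : jet_scheme m R) :
  jet_trunc_component lt (fmap phi p) = fmap phi (jet_trunc_component lt p).
Proof.
pose chi : {lrmorphism truncpoly R m -> truncpoly S m'} :=
  truncpoly_trunc lt \o truncpoly_map phi (m := m).
rewrite /jet_trunc_component /= /jet_fmap.
rewrite -[LHS](@fmap_comp k X _ _ _ _ _ chi) //.
apply: fmap_comp => q; apply/truncpolyP => i le; have le' := leq_trans le (ltnW lt).
by rewrite /comp coef_truncpoly_trunc // !coef_truncpoly_map // coef_truncpoly_trunc.
Qed.

Definition jet_trunc (m' m : nat) (lt : (m' < m)%N) :
    kmorphism (jet_scheme m) (jet_scheme m') :=
  Morphism (jet_trunc_natural lt).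

End Jets.

Section ProjectiveLimit.
Variables (k : fieldType) (X : nat -> kfunctor k).
Variable tr : forall m' m : nat, (m' < m)%N -> kmorphism (X m) (X m').

Definition lim_points (R : comAlgType k) : Type :=
  {p : forall m, X m R | forall m' m (lt : (m' < m)%N), tr lt R (p m) = p m'}.

Fact lim_fmap_subproof (R S : comAlgType k) (phi : {lrmorphism R -> S})
    (p : lim_points R) m' m (lt : (m' < m)%N) :
  tr lt S (fmap phi (sval p m)) = fmap phi (sval p m').
Proof. by rewrite naturality (svalP p). Qed.

Definition lim_fmap (R S : comAlgType k) (phi : {lrmorphism R -> S})
    (p : lim_points R) : lim_points S :=
  exist _ (fun m => fmap phi (sval p m)) (lim_fmap_subproof phi p).

Fact lim_fmap_id (R : comAlgType k) (phi : {lrmorphism R -> R}) :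
  phi =1 id -> lim_fmap phi =1 id.
Proof.
move=> e [p cp]; rewrite /lim_fmap /=; apply: eq_exist.
by apply: functional_extensionality_dep => m; exact: fmap_id.
Qed.

Fact lim_fmap_comp (R S T : comAlgType k) (phi : {lrmorphism R -> S})
    (psi : {lrmorphism S -> T}) (chi : {lrmorphism R -> T}) :
  chi =1 psi \o phi -> lim_fmap chi =1 lim_fmap psi \o lim_fmap phi.
Proof.
move=> e [p cp]; rewrite /comp /lim_fmap /=; apply: eq_exist.
by apply: functional_extensionality_dep => m; exact: fmap_comp.
Qed.

Definition projlim : kfunctor k := KFunctor lim_fmap_id lim_fmap_comp.

End ProjectiveLimit.

Definition arc_space (k : fieldType) (X : kfunctor k) : kfunctor k :=
  projlim (jet_trunc X).

Definition varx {k : fieldType} : {mpoly k[3]} := 'X_(@Ordinal 3 0 isT).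
Definition vary {k : fieldType} : {mpoly k[3]} := 'X_(@Ordinal 3 1 isT).
Definition varz {k : fieldType} : {mpoly k[3]} := 'X_(@Ordinal 3 2 isT).

(* Main.v *)
Require Import Defs.
From HB Require Import structures.
From mathcomp Require Import all_boot all_order all_algebra.
From mathcomp Require Import boolp reals complex mpoly ring zify.

(* The surfaces X and Y are G_a-torsors over the affine line with doubled
   origin, so their fibre product is both X * A^1 and Y * A^1 (Danielewski).
   As X and Y are smooth with trivial tangent bundle, X_m is X * A^(2m) and Y_m
   is Y * A^(2m), compatibly with truncation; for m > 0 there is thus a factor
   A^1 over which X can be exchanged for Y.
     To tell X from Y, suppose that k[Y] = k[a, b, c] with ac = b^2 - 1.  Any
   Poisson bracket on k[Y] makes a, b, c span sl_2 up to a factor, which is a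
   unit for the bracket with {x, y} = x^2, hence a constant; so {a, -} and
   {c, -} are locally nilpotent.  On a chart A^2 of Y, elements of k[Y] have a
   leading monomial x^e s^j with e >= j, and comparing leading monomials shows
   that {a, -} is nilpotent at x only if a is in k[x].  Hence a and c are in
   k[x], and {a, c} = 0 gives a contradiction. *)

Set Implicit Arguments.
Unset Strict Implicit.
Unset Printing Implicit Defensive.

Import GRing.Theory.
Local Open Scope ring_scope.

(** * Natural transformations between hypersurfaces *)

Section GeneratedSubalgebra.
Variables (k : fieldType) (A : comAlgType k) (n : nat) (v : 'I_n -> A).

Definition generated : pred A :=
  fun a => `[< exists p : {mpoly k[n]}, mmap (in_alg A) v p = a >].

Lemma generatedP a :
  reflect (exists p : {mpoly k[n]}, mmap (in_alg A) v p = a) (a \in generated).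
Proof. exact: asboolP. Qed.

Fact generated_subalg : subalg_closed generated.
Proof.
split=> [|a _ _ /generatedP[p <-] /generatedP[q <-]|_ _ /generatedP[p <-] /generatedP[q <-]].
- by apply/generatedP; exists 1; rewrite rmorph1.
- by apply/generatedP; exists (a *: p + q); rewrite mmapD mmapZ /= mulr_algl.
- by apply/generatedP; exists (p * q); rewrite rmorphM.
Qed.
HB.instance Definition _ := GRing.isSubalgClosed.Build k A generated generated_subalg.

Definition gensub := {a : A | a \in generated}.
HB.instance Definition _ := SubChoice.on gensub.
HB.instance Definition _ := [SubChoice_isSubComNzRing of gensub by <:].
HB.instance Definition _ := [SubZmodule_isSubLmodule of gensub by <:].
HB.instance Definition _ := [SubNzRing_SubLmodule_isSubLalgebra of gensub by <:].
HB.instance Definition _ := [SubLalgebra_isSubAlgebra of gensub by <:].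

Definition gensub_val (a : gensub) : A := val a.

HB.instance Definition _ := GRing.isLinear.Build k gensub A _ gensub_val
  (linearP (val : {linear gensub -> A})).
HB.instance Definition _ := GRing.isMonoidMorphism.Build gensub A gensub_val
  (conj (rmorph1 (val : {rmorphism gensub -> A})) (rmorphM (val : {rmorphism gensub -> A}))).

Lemma gensub_valP a : gensub_val a \in generated.
Proof. exact: valP. Qed.

Lemma generated_gen i : v i \in generated.
Proof. by apply/generatedP; exists 'X_i; rewrite mmapX mmap1U. Qed.

Lemma generated_ind (P : A -> Prop) :
    (forall c : k, P c%:A) -> (forall i, P (v i)) ->
    (forall a b, P a -> P b -> P (a + b)) ->
    (forall a b, P a -> P b -> P (a * b)) ->
  forall a, a \in generated -> P a.
Proof.
move=> Pc Pv PD PM _ /generatedP[p <-].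
have P0 : P 0 by rewrite -(scale0r 1); apply: Pc.
have P1 : P 1 by rewrite -(scale1r 1); apply: Pc.
rewrite /mmap; apply: (big_ind P P0 PD) => m _; apply/PM; first exact: Pc.
apply: (big_ind P P1 PM) => i _.
by elim: (m i) => [|e IH]; rewrite ?exprS //; apply: PM.
Qed.
End GeneratedSubalgebra.

Lemma mmap_morph (k : fieldType) (R S : comAlgType k) (phi : {lrmorphism R -> S})
    n (v : 'I_n -> R) (w : 'I_n -> S) (p : {mpoly k[n]}) :
  (forall i, phi (v i) = w i) -> phi (mmap (in_alg R) v p) = mmap (in_alg S) w p.
Proof.
move=> vw; rewrite /mmap raddf_sum; apply: eq_bigr => m _ /=.
rewrite rmorphM /= rmorph_alg /mmap1 rmorph_prod; congr (_ * _).
by apply: eq_bigr => i _; rewrite -vw -rmorphXn.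
Qed.

(** Every point comes from one over the subalgebra generated by its coordinates, and naturality
    keeps its image inside that subalgebra. This takes the place of a map of coordinate rings. *)
Lemma component_generated (k : fieldType) n (f g : {mpoly k[n]})
    (phi : kmorphism (hypersurface f) (hypersurface g)) (R : comAlgType k)
    (p : hypersurface f R) i :
  val (phi R p) i \in generated (val p).
Proof.
pose S := gensub (val p).
pose v : {ffun 'I_n -> S} := [ffun j => exist _ (val p j) (generated_gen (val p) j)].
have vf : mmap (in_alg S) v f == 0.
  have vE j : gensub_val (v j) = val p j by rewrite ffunE.
  by apply/eqP/val_inj; rewrite [LHS](mmap_morph f vE); apply/eqP/(valP p).
pose q : hypersurface f S := exist _ v vf.
have pE : p = fmap (gensub_val (v := val p)) q.
  by apply/val_inj/ffunP => j; rewrite !ffunE.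
by rewrite {1}pE naturality /= ffunE; apply: gensub_valP.
Qed.

(** * The Poisson bracket of the affine plane *)

Section Bracket.
Variable k : fieldType.
Implicit Types f g : {poly {poly k}}.

(** The outer variable is s and the inner one x, so this is f_x g_s - f_s g_x. *)
Definition bracket f g : {poly {poly k}} :=
  map_poly deriv f * g^`() - f^`() * map_poly deriv g.

Lemma map_derivM f g : map_poly deriv (f * g) =
  map_poly deriv f * g + f * map_poly deriv g.
Proof.
apply/polyP => i; rewrite coefD coef_map !coefM /= raddf_sum -big_split /=.
by apply: eq_bigr => j _; rewrite derivM !coef_map.
Qed.

Lemma bracketC f g : bracket f g = - bracket g f.
Proof. by rewrite /bracket; ring. Qed.

Lemma bracketff f : bracket f f = 0.
Proof. by rewrite /bracket; ring. Qed.

Lemma bracketD f g1 g2 : bracket f (g1 + g2) = bracket f g1 + bracket f g2.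
Proof. by rewrite /bracket !raddfD /=; ring. Qed.

Lemma bracketM f g1 g2 :
  bracket f (g1 * g2) = bracket f g1 * g2 + g1 * bracket f g2.
Proof. by rewrite /bracket map_derivM derivM; ring. Qed.

Lemma bracketC0 f c : bracket f c%:P%:P = 0.
Proof.
rewrite /bracket derivC mulr0 map_polyC /= derivC.
by rewrite polyC0 mulr0 subrr.
Qed.

Lemma bracketCC (p q : {poly k}) : bracket p%:P q%:P = 0.
Proof. by rewrite /bracket !derivC mulr0 mul0r subrr. Qed.

(* Bounds the leading bidegree for the order where s dominates x. *)
Definition bideg_le f e j := (size f <= j.+1)%N /\ (size (f`_j)%R <= e.+1)%N.

Lemma coefM_top (R : nzRingType) (p q : {poly R}) i j :
  (size p <= i.+1)%N -> (size q <= j.+1)%N -> (p * q)`_(i + j) = p`_i * q`_j.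
Proof.
move=> sp sq; rewrite coefM.
have lt : (i < (i + j).+1)%N by rewrite ltnS leq_addr.
rewrite (bigD1 (Ordinal lt)) //= addKn big1 ?addr0 // => l ne.
have [lt1|gt1|eq1] := ltngtP (l : nat) i.
- rewrite [q`__]nth_default ?mulr0 //; apply: leq_trans sq _; lia.
- by rewrite [p`__]nth_default ?mul0r //; apply: leq_trans sp _.
- by case/eqP: ne; apply: val_inj.
Qed.

Lemma size_mul_le (R : nzRingType) (p q : {poly R}) i j :
  (size p <= i.+1)%N -> (size q <= j.+1)%N -> (size (p * q)%R <= (i + j).+1)%N.
Proof.
move: (size_polyMleq p q); move: (size (p * q)%R) (size p) (size q) => l m n; lia.
Qed.

Lemma bideg_leM f g e j p q : bideg_le f e j -> bideg_le g p q ->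
  bideg_le (f * g) (e + p) (j + q) /\
  (f * g)`_(j + q)`_(e + p) = f`_j`_e * g`_q`_p.
Proof.
move=> [fj fe] [gq gp]; rewrite /bideg_le coefM_top // coefM_top //.
by split=> //; split; apply: size_mul_le.
Qed.

Lemma bideg_leB f g e j : bideg_le f e j -> bideg_le g e j -> bideg_le (f - g) e j.
Proof.
move=> [fj fe] [gj ge]; split; rewrite ?coefB.
  by rewrite (leq_trans (size_polyD _ _)) // geq_max size_polyN fj.
by rewrite (leq_trans (size_polyD _ _)) // geq_max size_polyN fe.
Qed.

Lemma coef_eulerx f i l : ('X%:P * map_poly deriv f)`_i`_l = f`_i`_l *+ l.
Proof.
rewrite coefCM coef_map /= coefXM coef_deriv.
by case: l => //=; rewrite mulr0n.
Qed.

Lemma coef_eulers f i : ('X * f^`())`_i = f`_i *+ i.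
Proof. by rewrite coefXM coef_deriv; case: i => //=; rewrite mulr0n. Qed.

Lemma coef2_eulers f i l : ('X * f^`())`_i`_l = f`_i`_l *+ i.
Proof. by rewrite coef_eulers coefMn. Qed.

Lemma bideg_le_eulerx f e j :
  bideg_le f e j -> bideg_le ('X%:P * map_poly deriv f) e j.
Proof.
move=> [fj fe]; split; apply/leq_sizeP => i lt; last first.
  by rewrite coef_eulerx (nth_default 0 (leq_trans fe lt)) mul0rn.
by apply/polyP => l; rewrite coef_eulerx (nth_default 0 (leq_trans fj lt)) !coef0 mul0rn.
Qed.

Lemma bideg_le_eulers f e j : bideg_le f e j -> bideg_le ('X * f^`()) e j.
Proof.
move=> [fj fe]; split.
  apply/leq_sizeP => i lt.
  by rewrite coef_eulers (nth_default 0 (leq_trans fj lt)) mul0rn.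
by rewrite coef_eulers -mulr_natr -polyC_natr mulrC mul_polyC (leq_trans (size_scale_leq _ _)).
Qed.

(* Multiplied by x s, the bracket becomes an expression in the Euler operators
   x d/dx and s d/ds, which respect bidegrees. *)
Lemma bideg_le_bracket f g e j p q :
  bideg_le f e.+1 j.+1 -> bideg_le g p q ->
  bideg_le (bracket f g) (e + p) (j + q) /\
  (bracket f g)`_(j + q)`_(e + p) =
    f`_j.+1`_e.+1 * g`_q`_p * ((e.+1 * q)%:R - (j.+1 * p)%:R).
Proof.
move=> df dg.
have eulerE : 'X%:P * bracket f g * 'X =
    'X%:P * map_poly deriv f * ('X * g^`()) - 'X * f^`() * ('X%:P * map_poly deriv g).
  by rewrite /bracket; ring.
have [d1 c1] := bideg_leM (bideg_le_eulerx df) (bideg_le_eulers dg).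
have [d2 c2] := bideg_leM (bideg_le_eulers df) (bideg_le_eulerx dg).
have := bideg_leB d1 d2; rewrite -eulerE => -[].
have coefE i l : ('X%:P * bracket f g * 'X)`_i.+1`_l.+1 = (bracket f g)`_i`_l.
  by rewrite coefMX coefCM coefXM.
have coefE0 i : ('X%:P * bracket f g * 'X)`_i.+1 = 'X * (bracket f g)`_i.
  by rewrite coefMX coefCM.
rewrite !addSn coefE0 => /leq_sizeP sz1 /leq_sizeP sz2; split; last first.
  rewrite -coefE eulerE coefB coefB -!addSn c1 c2 !coef_eulerx !coef2_eulers.
  by rewrite !(mulrnAl, mulrnAr) -!mulrnA mulrBr !mulr_natr !(mulnC e.+1) !(mulnC j.+1).
split; apply/leq_sizeP => i lt.
  by apply/polyP => l; rewrite -coefE sz1 ?coef0.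
by have := sz2 i.+1 lt; rewrite coefXM.
Qed.

Hypothesis natr_eq0 : forall n, (n%:R == 0 :> k) = (n == 0)%N.

(* If a has leading monomial x^e s^j, then {a, -}^n x has leading monomial
   x^(1 + n(e - 1)) s^(n(j - 1)), with a nonzero coefficient because e >= j. *)
Lemma iter_bracket_neq0 (a : {poly {poly k}}) n :
  (1 < size a <= size (lead_coef a))%N -> iter n (bracket a) 'X%:P != 0.
Proof.
move=> /andP[sz1 sz2].
(* Both are one less than the leading exponents of [a]: the amounts by which {a, -} raises
   bidegrees. *)
set j := (size a).-2; set e := (size (lead_coef a)).-2.
have sza : size a = j.+2 by rewrite /j; case: (size a) sz1 => [|[]].
have sze : size (lead_coef a) = e.+2.
  by rewrite /e; case: (size (lead_coef a)) (leq_trans sz1 sz2) => [|[]].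
have aj : a`_j.+1 = lead_coef a by rewrite lead_coefE sza.
have da : bideg_le a e.+1 j.+1 by rewrite /bideg_le aj sza sze.
have nz : a`_j.+1`_e.+1 != 0.
  by rewrite aj -[e.+1]/(e.+2.-1) -sze -lead_coefE !lead_coef_eq0 -size_poly_eq0 sza.
have le : (j <= e)%N by move: sz2; rewrite sza sze !ltnS.
suff [_] : bideg_le (iter n (bracket a) 'X%:P) (n * e).+1 (n * j) /\
    (iter n (bracket a) 'X%:P)`_(n * j)`_(n * e).+1 != 0.
  by apply: contraNneq => ->; rewrite !coef0.
elim: n => [|n [IHd IHc]].
  by rewrite !mul0n /bideg_le coefC size_polyX coefX oner_eq0 (leq_trans (size_polyC_leq1 _)).
have [] := bideg_le_bracket da IHd.
rewrite addnS -!mulSn iterS => d c; split=> //; rewrite c.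
rewrite !mulf_neq0 //.
(* The new factor is -(n (e - j) + j + 1), nonzero in characteristic zero because e >= j. *)
have -> : (j.+1 * (n * e).+1 = e.+1 * (n * j) + (n * (e - j) + j).+1)%N.
  rewrite -{1 2}(subnK le); move: (e - j)%N => d0; ring.
by rewrite natrD opprD addrA subrr add0r oppr_eq0 natr_eq0.
Qed.

End Bracket.

(** * Nilpotency of a derivation at single elements *)

Section LocallyNilpotent.
Variables (A : comNzRingType) (D : A -> A).
Hypothesis DD : {morph D : f g / f + g}.
Hypothesis DM : forall f g, D (f * g) = D f * g + f * D g.

Definition killed f := exists n, iter n D f = 0.

Let D0 : D 0 = 0.
Proof. by apply: (addrI (D 0)); rewrite -DD !addr0. Qed.

Let iterDD n f g : iter n D (f + g) = iter n D f + iter n D g.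
Proof. by elim: n => //= n ->; rewrite DD. Qed.

Let iter0 n : iter n D 0 = 0.
Proof. by elim: n => //= n ->. Qed.

Lemma iter_killed_leq m n f : (m <= n)%N -> iter m D f = 0 -> iter n D f = 0.
Proof. by move=> /subnK <- e; rewrite iterD e. Qed.

Lemma killedD f g : killed f -> killed g -> killed (f + g).
Proof.
move=> [m fm] [n gn]; exists (m + n)%N.
by rewrite iterDD (iter_killed_leq _ fm) ?(iter_killed_leq _ gn) ?leq_addr ?leq_addl ?addr0.
Qed.

Lemma killedM f g : killed f -> killed g -> killed (f * g).
Proof.
(* Induction on a bound s for m + n avoids binomial coefficients: each term of D f g + f D g has one
   of the two orders lowered. *)
suff H s : forall m n f' g', (m + n <= s)%N ->
    iter m D f' = 0 -> iter n D g' = 0 -> iter s D (f' * g') = 0.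
  by move=> [m fm] [n gn]; exists (m + n)%N; apply: H fm gn.
elim: s => [|s IH] [|m] [|n] {}f {}g // le fm gn;
  rewrite ?[f]fm ?[g]gn ?mul0r ?mulr0 ?iter0 //.
have [le1 le2] : (m + n.+1 <= s)%N /\ (m.+1 + n <= s)%N by lia.
rewrite iterSr DM iterDD (IH _ _ _ _ le1) -?iterSr //.
by rewrite (IH _ _ _ _ le2) -?iterSr ?addr0.
Qed.

Lemma killed_preim f : killed (D f) -> killed f.
Proof. by move=> [n e]; exists n.+1; rewrite iterSr. Qed.

Lemma killed_ker f : D f = 0 -> killed f.
Proof. by move=> e; exists 1%N. Qed.

End LocallyNilpotent.

(* In a Poisson algebra, three elements with ac = b^2 - 1 span sl_2 up to the
   factor H; the relation allows one to divide by a, b and c. *)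
Lemma sl2_relations (A : comNzRingType) (a b c ab ac bc : A) :
    a * c = b ^+ 2 - 1 ->
    a * ac = 2%:R * b * ab -> c * ac = 2%:R * b * bc -> a * bc = c * ab ->
  let H := b * ac - 2%:R * c * ab in
  [/\ 2%:R * ab = a * H, ac = b * H & 2%:R * bc = c * H].
Proof.
move=> E Ea Ec Eb H; rewrite /H; split.
- rewrite mulrBr (mulrCA a) Ea.
  have -> : a * (2%:R * c * ab) = 2%:R * (a * c) * ab by ring.
  by rewrite E; ring.
- have -> : b * (b * ac - 2%:R * c * ab) = b ^+ 2 * ac - c * (2%:R * b * ab) by ring.
  rewrite -Ea; have -> : c * (a * ac) = a * c * ac by ring.
  by rewrite E; ring.
have -> : c * (b * ac - 2%:R * c * ab) = b * (c * ac) - 2%:R * c * (c * ab) by ring.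
rewrite Ec -Eb.
have -> : 2%:R * c * (a * bc) = 2%:R * (a * c) * bc by ring.
by rewrite E; ring.
Qed.

(** * A chart of Y and the leading monomials of its regular functions *)

Section Chart.
Variable k : fieldType.
Local Notation P := {poly {poly k}}.

(* The chart (x, s) |-> (x, 1 + x^2 s, 2 s + x^2 s^2) of the surface
   x^2 z = y^2 - 1: it identifies A^2 with the complement of the line
   x = 0, y = -1. *)
Definition chartx : P := 'X%:P.
Definition charty : P := 1 + 'X%:P ^+ 2 * 'X.
Definition chartz : P := 2%:R * 'X + 'X%:P ^+ 2 * 'X ^+ 2.

Lemma chart_eq : chartx ^+ 2 * chartz - charty ^+ 2 + 1 = 0.
Proof. by rewrite /chartx /charty /chartz; ring. Qed.

(* The coordinate ring k[x, y, z] of the surface is free on 1, y over k[x, z]. *)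
Definition regular (f : P) := exists p q : P, f = p \Po chartz + charty * (q \Po chartz).

Lemma regularC (c : {poly k}) : regular c%:P.
Proof. by exists c%:P, 0; rewrite comp_polyC comp_poly0 mulr0 addr0. Qed.

Lemma regulary : regular charty.
Proof. by exists 0, 1; rewrite comp_poly0 comp_polyC mulr1 add0r. Qed.

Lemma regularz : regular chartz.
Proof. by exists 'X, 0; rewrite comp_polyX comp_poly0 mulr0 addr0. Qed.

Lemma regularD f g : regular f -> regular g -> regular (f + g).
Proof.
move=> [p [q ->]] [p' [q' ->]]; exists (p + p'), (q + q').
by rewrite !comp_polyD; ring.
Qed.

Lemma regularM f g : regular f -> regular g -> regular (f * g).
Proof.
move=> [p [q ->]] [p' [q' ->]].
(* The product of the two y-terms is reduced by y^2 = 1 + x^2 z. *)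
exists (p * p' + (1 + 'X%:P ^+ 2 * 'X) * (q * q')), (p * q' + p' * q).
rewrite !(comp_polyD, comp_polyM) !comp_polyC comp_polyX.
have -> : 1 + 'X%:P * 'X%:P * chartz = charty ^+ 2 by rewrite /charty /chartz; ring.
by ring.
Qed.

Let chartz_seq : chartz = Poly [:: 0; 2%:R; 'X^2].
Proof. by rewrite /chartz /= !cons_poly_def; ring. Qed.

Lemma size_chartz : size chartz = 3.
Proof.
rewrite chartz_seq (PolyK (c := 0)) //=.
by rewrite expf_neq0 // polyX_eq0.
Qed.

Lemma lead_coef_chartz : lead_coef chartz = 'X^2.
Proof. by rewrite lead_coefE size_chartz chartz_seq coef_Poly. Qed.

Let charty_seq : charty = Poly [:: 1; 'X^2].
Proof. by rewrite /charty /= !cons_poly_def; ring. Qed.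

Lemma size_charty : size charty = 2.
Proof.
rewrite charty_seq (PolyK (c := 0)) //=.
by rewrite expf_neq0 // polyX_eq0.
Qed.

Lemma lead_coef_charty : lead_coef charty = 'X^2.
Proof. by rewrite lead_coefE size_charty charty_seq coef_Poly. Qed.

Lemma size_comp_chartz (p : P) : p != 0 ->
  size (p \Po chartz) = (2 * (size p).-1).+1.
Proof.
move=> nz; have := size_comp_poly p chartz.
rewrite size_chartz mulnC /= => <-; rewrite prednK // size_poly_gt0.
by rewrite comp_poly_eq0 // size_chartz.
Qed.

(** As polynomials in s, z and y have leading terms x^2 s^2 and x^2 s, so a leading term of s-degree
    j carries at least x^j. The s-degree is even for p(z) and odd for y q(z), so these two parts
    cannot cancel. *)
Lemma regular_size (f : P) : regular f -> (size f <= size (lead_coef f))%N.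
Proof.
move=> [p [q ->]].
have leadp (r : P) : r != 0 ->
    (2 * (size r).-1 < size (lead_coef (r \Po chartz)))%N.
  move=> nz; rewrite lead_coef_comp ?size_chartz // lead_coef_chartz -exprM.
  rewrite size_mulXn ?lead_coef_eq0 // -[X in (X < _)%N]addn0 ltn_add2l.
  by rewrite size_poly_gt0 lead_coef_eq0.
have nzc (r : P) : r != 0 -> r \Po chartz != 0.
  by rewrite comp_poly_eq0 // size_chartz.
have szq (r : P) : r != 0 -> size (charty * (r \Po chartz)) = (2 * (size r).-1).+2.
  move=> nz; rewrite size_mul ?nzc // -?size_poly_eq0 size_charty //.
  by rewrite size_comp_chartz.
have leadq (r : P) : r != 0 ->
    (size (charty * (r \Po chartz))%R <= size (lead_coef (charty * (r \Po chartz))%R))%N.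
  move=> nz; rewrite szq // lead_coefM lead_coef_charty mulrC size_mulXn.
    by have := leadp r nz; rewrite !addSn add0n ltnS => /ltnW.
  by rewrite lead_coef_eq0 nzc.
have [->|pnz] := eqVneq p 0.
  rewrite comp_poly0 add0r; have [->|qnz] := eqVneq q 0; last exact: leadq.
  by rewrite comp_poly0 mulr0 size_poly0.
have [->|qnz] := eqVneq q 0.
  by rewrite comp_poly0 mulr0 addr0 size_comp_chartz // leadp.
have := leadq q qnz; rewrite szq // => leq; have := leadp p pnz => lep.
have [lt|ge] := leqP (size p) (size q).
  have lt' : (size (p \Po chartz) < size (charty * (q \Po chartz))%R)%N.
    rewrite size_comp_chartz // szq // !ltnS leq_mul2l /=.
    by rewrite -ltnS !prednK // size_poly_gt0.
  by rewrite addrC size_polyDl // lead_coefDl // szq.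
have lt' : (size (charty * (q \Po chartz))%R < size (p \Po chartz))%N.
  rewrite size_comp_chartz // szq //.
  move: (size_poly_gt0 q) ge; rewrite qnz; move: (size p) (size q) => m n; lia.
by rewrite size_polyDl // lead_coefDl // size_comp_chartz.
Qed.
End Chart.

(** * The surfaces are not isomorphic *)

(* As for truncpoly, the alias carries the k-algebra structure, whereas
   {poly {poly k}} is only a {poly k}-algebra. *)
Definition bipoly (k : fieldType) : Type := {poly {poly k}}.

Section Bipoly.
Variable k : fieldType.
Local Notation T := (bipoly k).

HB.instance Definition _ := GRing.ComNzRing.on T.

Definition bipoly_scale (a : k) (p : T) : T := a%:P *: (p : {poly {poly k}}).

Fact bipoly_scaleA a b p : bipoly_scale a (bipoly_scale b p) = bipoly_scale (a * b) p.
Proof. by rewrite /bipoly_scale scalerA polyCM. Qed.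

Fact bipoly_scale1 : left_id 1 bipoly_scale.
Proof. by move=> p; rewrite /bipoly_scale scale1r. Qed.

Fact bipoly_scaleDr : right_distributive bipoly_scale +%R.
Proof. by move=> a p q; rewrite /bipoly_scale scalerDr. Qed.

Fact bipoly_scaleDl p : {morph bipoly_scale^~ p : a b / a + b}.
Proof. by move=> a b; rewrite /bipoly_scale polyCD scalerDl. Qed.

HB.instance Definition _ := GRing.Zmodule_isLmodule.Build k T
  bipoly_scaleA bipoly_scale1 bipoly_scaleDr bipoly_scaleDl.

Fact bipoly_scaleAl (a : k) (p q : T) : a *: (p * q) = a *: p * q.
Proof. exact: (@scalerAl {poly k} {poly {poly k}}). Qed.

HB.instance Definition _ := GRing.Lmodule_isLalgebra.Build k T bipoly_scaleAl.
HB.instance Definition _ := GRing.Lalgebra_isComAlgebra.Build k T.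

Lemma bipoly_alg (a : k) : a%:A = a%:P%:P :> T.
Proof. by rewrite -[LHS]/(a%:P *: (1 : {poly {poly k}})) alg_polyC. Qed.

End Bipoly.

Section Point.
Variables (k : fieldType) (A : comAlgType k).

Definition triple (x y z : A) : {ffun 'I_3 -> A} := [ffun i => tnth [tuple x; y; z] i].

Definition i0 : 'I_3 := @Ordinal 3 0 isT.
Definition i1 : 'I_3 := @Ordinal 3 1 isT.
Definition i2 : 'I_3 := @Ordinal 3 2 isT.

Lemma ord3P (P : 'I_3 -> Prop) : P i0 -> P i1 -> P i2 -> forall i, P i.
Proof.
by move=> p0 p1 p2 [[|[|[|//]]] lt]; rewrite (bool_irrelevance lt isT).
Qed.

Definition danielewski (n : nat) : {mpoly k[3]} := varx ^+ n * varz - vary ^+ 2 + 1.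

Lemma mmap_danielewski n (v : 'I_3 -> A) :
  mmap (in_alg A) v (danielewski n) = v i0 ^+ n * v i2 - v i1 ^+ 2 + 1.
Proof.
by rewrite /danielewski !(rmorphD, rmorphM, rmorphN, rmorphXn, rmorph1) /=
   !mmapX !mmap1U.
Qed.

End Point.

Section NotIsomorphic.
Variable k : fieldType.
Hypothesis natr_eq0 : forall n, (n%:R == 0 :> k) = (n == 0)%N.
Local Notation P := (bipoly k).
Local Notation Q := {poly {poly k}}.

Lemma generated_killed (v : 'I_3 -> P) (e f : P) :
    (forall i, killed (bracket e) (v i)) ->
  f \in generated v -> killed (bracket e) f.
Proof.
move=> kv; apply: generated_ind => // [c|a b|a b].
- by apply: killed_ker; rewrite bipoly_alg bracketC0.
- exact: (killedD (bracketD e)).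
- exact: (killedM (bracketD e) (bracketM e)).
Qed.

(** The bracket is a derivation in each argument, so induction over the generators runs once per
    argument, with antisymmetry in between. *)
Lemma generated_dvd_bracket (v : 'I_3 -> P) (h : Q) :
    (forall i j, exists q : Q, bracket (v i) (v j) = h * q) ->
  forall f g, f \in generated v -> g \in generated v ->
  exists q : Q, bracket f g = h * q.
Proof.
have ind e : (forall i, exists q : Q, bracket e (v i) = h * q) ->
    forall f, f \in generated v -> exists q : Q, bracket e f = h * q.
  move=> hv; apply: generated_ind => // [c|f g [p pE] [q qE]|f g [p pE] [q qE]].
  - by exists 0; rewrite bipoly_alg bracketC0 mulr0.
  - by exists (p + q); rewrite bracketD pE qE mulrDr.
  - by exists (p * g + f * q); rewrite bracketM pE qE; ring.
move=> hv f g fv gv; apply: (ind f) gv => i.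
have [q qE] := ind (v i) (hv i) f fv.
by exists (- q); rewrite bracketC qE mulrN.
Qed.

Lemma generated_regular (f : P) :
  f \in generated (@triple k P (chartx k) (charty k) (chartz k)) -> regular f.
Proof.
apply: generated_ind => [c||f1 f2|f1 f2].
- by rewrite bipoly_alg; apply: regularC.
- apply: ord3P; rewrite ffunE /tnth /=.
  + exact: regularC.
  + exact: regulary.
  + exact: regularz.
- exact: regularD.
- exact: regularM.
Qed.

Lemma bracketx (f : {poly {poly k}}) : bracket (chartx k) f = f^`().
Proof. by rewrite /bracket map_polyC /= !derivC derivX mul0r subr0 mul1r. Qed.

Lemma no_generators (a b c : Q) :
    a * c - b ^+ 2 + 1 = 0 -> regular a -> regular c ->
    (forall i, @triple k P (chartx k) (charty k) (chartz k) i \in generated (@triple k P a b c)) ->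
  False.
Proof.
move=> E ra rc gen.
have {}E : a * c = b ^+ 2 - 1 by apply/eqP; rewrite -subr_eq0 opprB addrA addrAC E.
pose ab := bracket a b; pose ac := bracket a c; pose bc := bracket b c.
pose H : Q := b * ac - 2%:R * c * ab.
(* Bracketing a c = b^2 - 1 with a, c and b yields the three relations that [sl2_relations]
   requires. *)
have sq e : bracket e (b ^+ 2 - 1) = 2%:R * b * bracket e b.
  have -> : b ^+ 2 - 1 = b * b + (-1)%:P%:P by rewrite !polyCN.
  by rewrite bracketD bracketM bracketC0; ring.
have Ea : a * ac = 2%:R * b * ab.
  by rewrite -sq -E bracketM bracketff mul0r add0r.
have Ec : c * ac = 2%:R * b * bc.
  have := sq c; rewrite -E bracketM bracketff mulr0 addr0 !(bracketC c).
  by rewrite mulNr mulrN mulrC => /oppr_inj.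
have Eb : a * bc = c * ab.
  have := sq b; rewrite -E bracketM bracketff mulr0 (bracketC b a) => /eqP.
  by rewrite mulNr addrC subr_eq0 => /eqP->; rewrite mulrC.
have [abH acH bcH] : [/\ 2%:R * ab = a * H, ac = b * H & 2%:R * bc = c * H].
  exact: sl2_relations.
pose half : Q := (2%:R^-1)%:P%:P.
have half2 : half * 2%:R = 1.
  by rewrite -!polyC_natr -!polyCM mulVf ?natr_eq0.
have two (p q : Q) : 2%:R * p = q -> p = half * q.
  by move=> <-; rewrite mulrA half2 mul1r.
have {}abH := two _ _ abH; have {}bcH := two _ _ bcH.
have table i j : exists q : Q,
    bracket (@triple k P a b c i) (@triple k P a b c j) = H * q.
  move: i j; apply: ord3P; apply: ord3P; rewrite !ffunE /tnth /=.
  - by exists 0; rewrite bracketff mulr0.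
  - by exists (half * a); rewrite -/ab abH; ring.
  - by exists b; rewrite -/ac acH; ring.
  - by exists (- (half * a)); rewrite bracketC -/ab abH; ring.
  - by exists 0; rewrite bracketff mulr0.
  - by exists (half * c); rewrite -/bc bcH; ring.
  - by exists (- b); rewrite bracketC -/ac acH; ring.
  - by exists (- (half * c)); rewrite bracketC -/bc bcH; ring.
  - by exists 0; rewrite bracketff mulr0.
have := gen i0; have := gen i1; have := gen i2; rewrite !ffunE /tnth /= => gz gy gx.
have [qy qyE] := generated_dvd_bracket table gx gy.
have [qz qzE] := generated_dvd_bracket table gx gz.
(* H divides {x, y} = x^2 and {x, z} = 2 y, hence also y {x, z} - 2 z {x, y} = 2 (y^2 - x^2 z) =
   2. *)
have Hunit : H * (half * (charty k * qz - 2%:R * chartz k * qy)) = 1.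
  have -> : H * (half * (charty k * qz - 2%:R * chartz k * qy)) =
      half * (charty k * (H * qz) - 2%:R * chartz k * (H * qy)) by ring.
  rewrite -qyE -qzE !bracketx.
  have -> : (charty k)^`() = 'X%:P ^+ 2.
    by rewrite /charty !derivE; ring.
  have -> : (chartz k)^`() = 2%:R * charty k.
    by rewrite /chartz /charty !derivE; ring.
  have -> : charty k * (2%:R * charty k) - 2%:R * chartz k * 'X%:P ^+ 2 = 2%:R.
    by rewrite /chartz /charty; ring.
  exact: half2.
have [h hE] : exists h : k, H = h%:P%:P.
  have /andP[/size_poly1P[h0 _ hE] u] : (size H == 1%N) && (H`_0 \is a GRing.unit).
    by rewrite -poly_unitE; apply/unitrPr; eexists; apply: Hunit.
  move: u; rewrite hE coefC poly_unitE => /andP[/size_poly1P[h _ ->] _].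
  by exists h.
have Hk e : killed (bracket e) H by rewrite hE; apply/killed_ker/bracketC0.
have halfk e : killed (bracket e) half by apply/killed_ker/bracketC0.
have mulk (e : Q) := killedM (bracketD e) (bracketM e).
(* If {e, -} is nilpotent at a, b and c, it is so at x; a positive s-degree of [e] would then
   contradict [iter_bracket_neq0]. *)
have const e : (forall i, killed (bracket e) (@triple k P a b c i)) -> regular e ->
    exists e0 : {poly k}, e = e0%:P.
  move=> ke /regular_size re.
  have [n] := generated_killed ke gx.
  have [/size1_polyC ->|lt] := leqP (size e) 1; first by eexists.
  by apply: contra_eqP => _; rewrite iter_bracket_neq0 // lt.
have [a0 aE] : exists a0 : {poly k}, a = a0%:P.
  apply: const => //.
  (* Up to constants, {a, -} sends c to b, b to a and a to 0; nilpotency is pulled back along this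
     chain. *)
  have ka : killed (bracket a) a by apply/killed_ker/bracketff.
  have kb : killed (bracket a) b.
    by apply: killed_preim; rewrite -/ab abH; apply/mulk/mulk.
  apply: ord3P; rewrite ffunE /tnth //=.
  by apply: killed_preim; rewrite -/ac acH; apply/mulk.
have [c0 cE] : exists c0 : {poly k}, c = c0%:P.
  apply: const => //.
  have kc : killed (bracket c) c by apply/killed_ker/bracketff.
  have kN (e f : Q) : killed (bracket e) f -> killed (bracket e) (- f).
    move=> kf; have -> : - f = f * (-1)%:P%:P by rewrite !polyCN mulrN1.
    by apply: mulk kf _; apply/killed_ker/bracketC0.
  have kb : killed (bracket c) b.
    by apply: killed_preim; rewrite bracketC -/bc bcH; apply/kN/mulk/mulk.
  apply: ord3P; rewrite ffunE /tnth //=.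
  by apply: killed_preim; rewrite bracketC -/ac acH; apply/kN/mulk.
(* As a and c lie in k[x], 0 = {a, c} = b H forces b = 0; then 2 {a, b} = a H forces a = 0, against
   a c = b^2 - 1. *)
have H0 : H != 0 by apply: contra_eq_neq Hunit => ->; rewrite mul0r eq_sym oner_eq0.
have b0 : b = 0.
  apply/eqP; have /eqP := acH; rewrite /ac aE cE bracketCC eq_sym mulf_eq0.
  by rewrite (negPf H0) orbF.
have a00 : a = 0.
  apply/eqP; have /eqP := abH; rewrite /ab b0 -polyC0 -polyC0 bracketC0 eq_sym !mulf_eq0.
  rewrite (negPf H0) orbF => /orP[/eqP half0|//].
  by move: half2 => /eqP; rewrite half0 mul0r eq_sym oner_eq0.
move: E => /eqP; rewrite a00 b0 mul0r expr0n /= sub0r eq_sym oppr_eq0.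
by rewrite oner_eq0.
Qed.

(** The chart is a point of Y over k[x, s]. Its coordinates and those of its image in X generate
    each other, by [component_generated] for the two inverse transformations. *)
Lemma not_isomorphic_danielewski :
  ~ isomorphic (hypersurface (danielewski k 1)) (hypersurface (danielewski k 2)).
Proof.
move=> [f [g fgK]].
have pE : mmap (in_alg P) (triple (chartx k : P) (charty k) (chartz k)) (danielewski k 2) == 0.
  by rewrite mmap_danielewski !ffunE; apply/eqP/chart_eq.
pose p : hypersurface (danielewski k 2) P :=
  exist _ (triple (chartx k : P) (charty k) (chartz k)) pE.
have [_ /(_ p) pK] := fgK P.
pose q := g P p; pose a := val q i0; pose b := val q i1; pose c := val q i2.
have qE : val q = triple a b c by apply/ffunP; apply: ord3P; rewrite !ffunE.
have abc : a * c - b ^+ 2 + 1 = 0.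
  by have /eqP := valP q; rewrite mmap_danielewski.
have reg i : regular (val q i).
  exact/generated_regular/(component_generated g p).
apply: (no_generators abc (reg i0) (reg i2)) => i.
by have := component_generated f q i; rewrite pK qE.
Qed.
End NotIsomorphic.

(** * Jets of the two surfaces over a single ring *)

(** Lets [ring] prove an equation modulo hypotheses, from explicit cofactors. *)
Lemma lincomb1 (R : comNzRingType) (c a b l r : R) :
  a = b -> l - r = c * (a - b) -> l = r.
Proof. by move=> -> e; apply/eqP; rewrite -subr_eq0 e subrr mulr0. Qed.

Lemma lincomb2 (R : comNzRingType) (c c' a b a' b' l r : R) :
  a = b -> a' = b' -> l - r = c * (a - b) + c' * (a' - b') -> l = r.
Proof. by move=> -> -> e; apply/eqP; rewrite -subr_eq0 e !subrr !mulr0 addr0. Qed.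

Lemma lincomb3 (R : comNzRingType) (c c' c'' a b a' b' a'' b'' l r : R) :
    a = b -> a' = b' -> a'' = b'' ->
  l - r = c * (a - b) + c' * (a' - b') + c'' * (a'' - b'') -> l = r.
Proof. by move=> -> -> -> e; apply/eqP; rewrite -subr_eq0 e !subrr !mulr0 !addr0. Qed.

Arguments lincomb1 {R} c {a b l r}.
Arguments lincomb2 {R} c c' {a b a' b' l r}.
Arguments lincomb3 {R} c c' c'' {a b a' b' a'' b'' l r}.

Section Danielewski.
Variables (R : comNzRingType) (h : R).
Hypothesis h2 : h * 2%:R = 1.
Implicit Types x y z c d : R.

(* Danielewski's isomorphism X * A^1 -> Y * A^1: both sides are the fibre
   product of the torsors X and Y over the line with doubled origin. *)
Definition cylinder x y z c y' z' d :=
  [/\ d = h * y * z - x * c, y' = y - x * d & z' = d ^+ 2 - z ^+ 2 + 2%:R * y * c].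

Lemma cylinder_eq x y z c y' z' d : x * z = y ^+ 2 - 1 ->
  cylinder x y z c y' z' d -> x ^+ 2 * z' = y' ^+ 2 - 1.
Proof.
move=> E [dE -> ->].
apply: (lincomb3 (1 - x * z) (2%:R * x * y) (x * y ^+ 2 * z) E dE h2); ring.
Qed.

Lemma cylinder_inv x y z c y' z' d : x * z = y ^+ 2 - 1 ->
  cylinder x y z c y' z' d ->
  [/\ y = y' + x * d, z = x * z' + 2%:R * y' * d + x * d ^+ 2 &
      c = h * y * (z' - d ^+ 2) + z * d].
Proof.
move=> E [dE -> ->]; split; first by ring.
  by apply: (lincomb3 z (- (2%:R * y)) (- (y ^+ 2 * z)) E dE h2); ring.
by apply: (lincomb3 c (- z) (- (y ^+ 2 * c)) E dE h2); ring.
Qed.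

Lemma cylinder_exists x y' z' d : x ^+ 2 * z' = y' ^+ 2 - 1 ->
  exists y z c, x * z = y ^+ 2 - 1 /\ cylinder x y z c y' z' d.
Proof.
(* The witnesses are the formulas of [cylinder_inv]. *)
move=> E; pose y := y' + x * d; pose z := x * z' + 2%:R * y' * d + x * d ^+ 2.
exists y, z, (h * y * (z' - d ^+ 2) + z * d).
have E1 : x * z = y ^+ 2 - 1 by apply: (lincomb1 1 E); rewrite /z /y; ring.
split=> //; split.
- by apply: (lincomb2 d (- (y ^+ 2 * d)) E1 h2); rewrite /z /y; ring.
- by rewrite /y; ring.
- by apply: (lincomb2 (z' - d ^+ 2) (- (y ^+ 2 * (z' - d ^+ 2))) E1 h2); rewrite /z /y; ring.
Qed.

End Danielewski.

(* The constant coefficient, the coefficient of t and the constants of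
   A = R[t]/(t^(m+1)) for m > 0. *)
Record jetting (R A : comNzRingType) := Jetting {
  cst : {rmorphism R -> A};
  res : {rmorphism A -> R};
  lin : {additive A -> R};
  tee : A;
  cstK : cancel cst res;
  res_tee : res tee = 0;
  lin_tee : forall d, lin (cst d * tee) = d;
  res_nilp : forall a, res a = 0 -> exists n, a ^+ n = 0
}.

(** * Fibre coordinates on jets and the exchange of X for Y *)

Section Fibre.
Variables (R A : comNzRingType) (J : jetting R A) (h : R).
Hypothesis h2 : h * 2%:R = 1.
Local Notation cst := (cst J).
Local Notation res := (res J).
Implicit Types x y z s r : A.

Let H2 : cst h * 2%:R = 1.
Proof. by rewrite -[2%:R](rmorph_nat cst) -rmorphM h2 rmorph1. Qed.

(** As n = 1 - u/2 is nilpotent, a finite geometric series inverts u/2 = 1 - n. *)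
Lemma unit_res2 u : res u = 2%:R -> exists v, u * v = 1.
Proof.
pose n := 1 - u * cst h.
move=> e; have [|N nN] := res_nilp (j := J) (a := n).
  by rewrite /n rmorphB rmorphM rmorph1 e cstK mulrC h2 subrr.
exists (cst h * \sum_(i < N) n ^+ i).
have := subrX1 n N; rewrite nN sub0r mulrA => /eqP.
rewrite -opprB mulNr eqr_opp => /eqP e'.
by rewrite [RHS]e' /n subKr.
Qed.

Lemma mulI_res2 u a b : res u = 2%:R -> a * u = b * u -> a = b.
Proof.
by move=> /unit_res2[v uv] /(congr1 ( *%R^~ v)); rewrite -!mulrA uv !mulr1.
Qed.

(** Newton iteration for e^(-1/2): with n = 1 - e, the step r1 = 1 + n/2 gives 1 - r1^2 e = n^2 (3 +
    n)/4, so the exponent that kills the error is halved, rounded up. *)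
Lemma inv_sqrt_exists e : res e = 1 -> exists r, res r = 1 /\ r ^+ 2 * e = 1.
Proof.
move=> e1; have [|N] := res_nilp (j := J) (a := 1 - e).
  by rewrite rmorphB rmorph1 e1 subrr.
elim/ltn_ind: N e e1 => -[|[|N]] IH e e1.
- by rewrite expr0 => /eqP; rewrite oner_eq0.
- rewrite expr1 => /eqP; rewrite subr_eq0 => /eqP <-.
  by exists 1; rewrite rmorph1 expr1n mulr1.
set n := 1 - e => nN; pose r1 := 1 + cst h * n.
have r11 : res r1 = 1.
  by rewrite /r1 /n rmorphD rmorphM rmorphB rmorph1 e1 subrr mulr0 addr0.
have n'E : 1 - r1 ^+ 2 * e = n ^+ 2 * (cst h ^+ 2 * (3%:R + n)).
  apply: (lincomb1 (- (n + 2%:R * cst h * n ^+ 2)) H2).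
  rewrite /r1 -[e](subKr 1) -/n; ring.
have [|||r [rr rE]] := IH (uphalf N.+2) _ (r1 ^+ 2 * e).
- by rewrite uphalf_half /=; lia.
- by rewrite rmorphM rmorphXn r11 e1 expr1n mulr1.
- rewrite n'E exprMn -exprM.
  have /subnK <- : (N.+2 <= 2 * uphalf N.+2)%N by rewrite mul2n uphalfK leq_addl.
  by rewrite exprD nN mulr0 mul0r.
exists (r * r1); rewrite rmorphM rr r11 mulr1; split=> //.
by rewrite exprMn -mulrA.
Qed.

(** Since e is a unit, (r - r') (r + r') = 0, and r + r' is a unit because it reduces to 2. *)
Lemma inv_sqrt_unique e r r' : res r = 1 -> res r' = 1 ->
  r ^+ 2 * e = 1 -> r' ^+ 2 * e = 1 -> r = r'.
Proof.
move=> rr rr' E E'; apply: (@mulI_res2 (r + r')); first by rewrite rmorphD rr rr'.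
apply/eqP; rewrite -subr_eq0 -mulrBl -subr_sqr; apply/eqP.
have -> : r ^+ 2 - r' ^+ 2 = (r ^+ 2 - r' ^+ 2) * (r ^+ 2 * e) by rewrite E mulr1.
have -> : (r ^+ 2 - r' ^+ 2) * (r ^+ 2 * e) = (r ^+ 2 * e - r' ^+ 2 * e) * r ^+ 2 by ring.
by rewrite E E' subrr mul0r.
Qed.

(* Coordinates (x, s, yr, zr) on the jets (x, y, z) of x^n z = y^2 - 1: the
   root r corrects (yr r, zr r^2) to a jet over x, and s moves it along the
   fibres by the G_a-action (y, z) |-> (y + x^n s, z + 2 y s + x^n s^2). *)
Definition fibre_coord n x y z s (yr zr : R) :=
  [/\ res s = 0, res x ^+ n * zr = yr ^+ 2 - 1 &
   exists r, [/\ res r = 1, r ^+ 2 * (cst yr ^+ 2 - x ^+ n * cst zr) = 1,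
     y = cst yr * r + x ^+ n * s &
     z = cst zr * r ^+ 2 + 2%:R * (cst yr * r) * s + x ^+ n * s ^+ 2]].

Lemma fibre_coord_eq n x y z s yr zr :
  fibre_coord n x y z s yr zr -> x ^+ n * z = y ^+ 2 - 1.
Proof.
move=> [_ _ [r [_ E -> ->]]].
by apply: (lincomb1 (-1) E); ring.
Qed.

Lemma fibre_coord_res n x y z s yr zr :
  fibre_coord n x y z s yr zr -> yr = res y /\ zr = res z.
Proof.
move=> [s0 _ [r [r1 _ -> ->]]].
rewrite !(rmorphD, rmorphM, rmorphXn) !cstK s0 r1 expr1n expr0n /=.
by rewrite !mulr0 !addr0 !mulr1.
Qed.

Lemma fibre_exists n x s yr zr : res s = 0 ->
  res x ^+ n * zr = yr ^+ 2 - 1 -> exists y z, fibre_coord n x y z s yr zr.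
Proof.
move=> s0 E; have [|r [r1 rE]] := @inv_sqrt_exists (cst yr ^+ 2 - x ^+ n * cst zr).
  by rewrite rmorphB (rmorphM _ (x ^+ n)) !rmorphXn !cstK E subKr.
by do 2!eexists; split=> //; exists r.
Qed.

Lemma fibre_unique n x y z y' z' s yr zr :
  fibre_coord n x y z s yr zr -> fibre_coord n x y' z' s yr zr -> y = y' /\ z = z'.
Proof.
move=> [_ _ [r [r1 rE -> ->]]] [_ _ [r' [r1' rE' -> ->]]].
by rewrite (inv_sqrt_unique r1 r1' rE rE').
Qed.

Lemma fibre_coord_exists n x y z : x ^+ n * z = y ^+ 2 - 1 ->
  exists s, fibre_coord n x y z s (res y) (res z).
Proof.
move=> E; have E0 : res x ^+ n * res z = res y ^+ 2 - 1.
  by rewrite -!rmorphXn -rmorphM E rmorphB rmorph1.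
have [|r [r1 rE]] := @inv_sqrt_exists (cst (res y) ^+ 2 - x ^+ n * cst (res z)).
  by rewrite rmorphB (rmorphM _ (x ^+ n)) !rmorphXn !cstK E0 subKr.
pose b := cst (res y) * r; pose c := cst (res z) * r ^+ 2.
have bE : x ^+ n * c = b ^+ 2 - 1.
  by apply: (lincomb1 (-1) rE); rewrite /b /c; ring.
have rb : res b = res y by rewrite rmorphM cstK r1 mulr1.
have rc : res c = res z by rewrite rmorphM rmorphXn cstK r1 expr1n mulr1.
(* If s carries (b, c) to (y, z), then b^2 - x^n c = 1 gives b (z - c) - 2 c (y - b) = s (2 + b (y -
   b)). The last factor reduces to 2, so it is a unit and s can be solved for. *)
have ru : res (2%:R + b * (y - b)) = 2%:R.
  by rewrite rmorphD rmorphM rmorphB rb subrr mulr0 addr0 rmorph_nat.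
have [v uv] := unit_res2 ru.
pose w := b * (z - c) - 2%:R * c * (y - b).
exists (w * v); split=> //.
  by rewrite rmorphM rmorphB !rmorphM !rmorphB rb rc !subrr !mulr0 subrr mul0r.
have wv a : a * (w * v) * (2%:R + b * (y - b)) = a * w.
  by rewrite -mulrA -(mulrA w) [v * _]mulrC uv mulr1.
have yE : y - b = x ^+ n * (w * v).
  apply: (mulI_res2 ru); rewrite wv.
  by apply: (lincomb2 (- b) (2%:R * y - b) E bE); rewrite /w; ring.
have zE : z - c = (y + b) * (w * v).
  apply: (mulI_res2 ru); rewrite wv.
  by apply: (lincomb2 (- (2%:R * c)) (2%:R * z) E bE); rewrite /w; ring.
exists r; split=> //; rewrite -/b -/c.
  by rewrite -yE subrKC.
rewrite -[LHS](subrKC c) zE -{1}(subrKC b y) yE; ring.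
Qed.

Lemma fibre_coord_unique n x y z s s' yr zr yr' zr' :
  fibre_coord n x y z s yr zr -> fibre_coord n x y z s' yr' zr' ->
  [/\ s = s', yr = yr' & zr = zr'].
Proof.
move=> F F'; have [yrE zrE] := fibre_coord_res F; have [yrE' zrE'] := fibre_coord_res F'.
split; rewrite ?yrE ?zrE //.
move: F F'; rewrite {}yrE {}zrE {}yrE' {}zrE'.
move=> [s0 _ [r [r1 rE yE zE]]] [s0' _ [r' [r1' rE' yE' zE']]].
have rr := inv_sqrt_unique r1 r1' rE rE'; subst r'.
set b := cst (res y) * r in yE zE yE' zE'; set c := cst (res z) * r ^+ 2 in zE zE'.
(* [x ^+ n] may be a zero divisor, so equal y do not suffice. Together with equal z and b^2 - x^n c
   = 1 they give (s - s') (2 + b x^n s) = 0, where the second factor is a unit. *)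
have ru : res (2%:R + b * (x ^+ n * s)) = 2%:R.
  by rewrite rmorphD !rmorphM s0 !mulr0 addr0 rmorph_nat.
have bE : x ^+ n * c = b ^+ 2 - 1.
  by apply: (lincomb1 (-1) rE); rewrite /b /c; ring.
have sE : x ^+ n * s = x ^+ n * s' by apply: (addrI b); rewrite -yE -yE'.
have tE : 2%:R * b * s + x ^+ n * s ^+ 2 = 2%:R * b * s' + x ^+ n * s' ^+ 2.
  by apply: (addrI c); rewrite !addrA -zE -zE'.
apply: (mulI_res2 ru).
apply: (lincomb3 b (- (2%:R * c + b * s')) (2%:R * (s - s')) tE sE bE).
by move: b c {yE zE yE' zE' ru bE sE tE} => b c; ring.
Qed.

(* The t-coefficient of s serves as the coordinate of A^1 in the cylinders. *)
Definition jet_rel x y z y' z' := exists s s' yr zr yr' zr',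
  [/\ fibre_coord 1 x y z s yr zr, fibre_coord 2 x y' z' s' yr' zr',
      cylinder h (res x) yr zr (lin J s) yr' zr' (lin J s') &
      s' - s = cst (lin J s' - lin J s) * tee J].

Let res_shift s d : res s = 0 -> res (s + cst d * tee J) = 0.
Proof. by move=> s0; rewrite rmorphD rmorphM res_tee mulr0 addr0. Qed.

Lemma jet_rel_eq x y z y' z' : jet_rel x y z y' z' ->
  x * z = y ^+ 2 - 1 /\ x ^+ 2 * z' = y' ^+ 2 - 1.
Proof. by move=> [s [s' [yr [zr [yr' [zr' [/fibre_coord_eq + /fibre_coord_eq]]]]]]]. Qed.

Lemma jet_rel_total x y z : x * z = y ^+ 2 - 1 -> exists y' z', jet_rel x y z y' z'.
Proof.
move=> E; have [s F] := @fibre_coord_exists 1 x y z E.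
have [s0 E0 _] := F.
pose d := h * res y * res z - res x * lin J s.
have C : cylinder h (res x) (res y) (res z) (lin J s) (res y - res x * d)
    (d ^+ 2 - res z ^+ 2 + 2%:R * res y * lin J s) d by [].
(* The t-coefficient of [s] is replaced by [d], the A^1-coordinate on the side of Y; the residue
   stays 0. *)
pose s' := s + cst (d - lin J s) * tee J.
have ds : lin J s' = d by rewrite raddfD /= lin_tee subrKC.
have [y' [z' F']] := fibre_exists (res_shift (d - lin J s) s0) (cylinder_eq h2 E0 C).
exists y', z'; do 6!eexists; split; [exact: F|exact: F'|by rewrite ds|].
by rewrite ds addrC addKr.
Qed.

Lemma jet_rel_surj x y' z' : x ^+ 2 * z' = y' ^+ 2 - 1 -> exists y z, jet_rel x y z y' z'.
Proof.
move=> E; have [s' F'] := @fibre_coord_exists 2 x y' z' E.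
have [s0 E0 _] := F'.
have [yr [zr [c [Er C]]]] := cylinder_exists h2 (lin J s') E0.
pose s := s' + cst (c - lin J s') * tee J.
have ds : lin J s = c by rewrite raddfD /= lin_tee subrKC.
have [y [z F]] := @fibre_exists 1 x _ yr zr (res_shift (c - lin J s') s0) Er.
exists y, z; do 6!eexists; split; [exact: F|exact: F'|by rewrite ds|].
by rewrite ds opprD addrA subrr sub0r -mulNr -rmorphN opprB.
Qed.

Lemma jet_rel_fun x y z y1 z1 y2 z2 :
  jet_rel x y z y1 z1 -> jet_rel x y z y2 z2 -> y1 = y2 /\ z1 = z2.
Proof.
move=> [s [s1 [yr [zr [yr1 [zr1 [F F1 [d1 ry1 rz1] S1]]]]]]].
move=> [s' [s2 [yr' [zr' [yr2 [zr2 [F' F2 [d2 ry2 rz2] S2]]]]]]].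
have [es ey ez] := fibre_coord_unique F F'; subst s' yr' zr'.
have ed : lin J s1 = lin J s2 by rewrite d1 d2.
have es : s1 = s2 by apply: (addIr (- s)); rewrite S1 S2 ed.
have ey : yr1 = yr2 by rewrite ry1 ry2 ed.
have ez : zr1 = zr2 by rewrite rz1 rz2 ed.
by subst; apply: fibre_unique F1 F2.
Qed.

Lemma jet_rel_inj x y' z' y1 z1 y2 z2 :
  jet_rel x y1 z1 y' z' -> jet_rel x y2 z2 y' z' -> y1 = y2 /\ z1 = z2.
Proof.
move=> [s1 [s [yr1 [zr1 [yr [zr [F1 F /(cylinder_inv h2)C1 S1]]]]]]].
move=> [s2 [s' [yr2 [zr2 [yr' [zr' [F2 F' /(cylinder_inv h2)C2 S2]]]]]]].
have [es ey ez] := fibre_coord_unique F F'; subst s' yr' zr'.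
have [_ E1 _] := F1; have [_ E2 _] := F2.
have [ry1 rz1 c1] := C1 E1; have [ry2 rz2 c2] := C2 E2.
have ey : yr1 = yr2 by rewrite ry1 ry2.
have ez : zr1 = zr2 by rewrite rz1 rz2.
have ec : lin J s1 = lin J s2 by rewrite c1 c2 ey ez.
have es : s1 = s2 by apply/oppr_inj/(addrI s); rewrite S1 S2 ec.
by subst; apply: fibre_unique F1 F2.
Qed.

End Fibre.

(** * Compatibility of the jet relation with ring maps *)

Section Functoriality.
Variables (R S A B : comNzRingType) (J : jetting R A) (K : jetting S B).
Variables (phi0 : {rmorphism R -> S}) (phi : {rmorphism A -> B}).
Hypothesis phi_cst : forall r, phi (cst J r) = cst K (phi0 r).
Hypothesis phi_res : forall a, res K (phi a) = phi0 (res J a).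
Hypothesis phi_lin : forall a, lin K (phi a) = phi0 (lin J a).
Hypothesis phi_tee : phi (tee J) = tee K.

Lemma fibre_coord_morph n x y z s yr zr : fibre_coord J n x y z s yr zr ->
  fibre_coord K n (phi x) (phi y) (phi z) (phi s) (phi0 yr) (phi0 zr).
Proof.
move=> [s0 E [r [r1 rE -> ->]]]; split.
- by rewrite phi_res s0 rmorph0.
- by rewrite phi_res -!(rmorphXn phi0) -(rmorphM phi0) E rmorphB rmorph1.
exists (phi r); split.
- by rewrite phi_res r1 rmorph1.
- by rewrite -!phi_cst -!(rmorphXn phi) -(rmorphM phi) -(rmorphB phi) -(rmorphM phi) rE rmorph1.
- by rewrite rmorphD !rmorphM rmorphXn phi_cst.
by rewrite !rmorphD !rmorphM !rmorphXn !phi_cst rmorph_nat.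
Qed.

Lemma jet_rel_morph h x y z y' z' : jet_rel J h x y z y' z' ->
  jet_rel K (phi0 h) (phi x) (phi y) (phi z) (phi y') (phi z').
Proof.
move=> [s [s' [yr [zr [yr' [zr' [F F' [C1 C2 C3] S1]]]]]]].
exists (phi s), (phi s'), (phi0 yr), (phi0 zr), (phi0 yr'), (phi0 zr'); split.
- exact: fibre_coord_morph.
- exact: fibre_coord_morph.
- rewrite phi_res !phi_lin; split.
  + by rewrite C1 rmorphB !rmorphM.
  + by rewrite C2 rmorphB rmorphM.
  by rewrite C3 rmorphD rmorphB !rmorphM rmorph_nat.
by rewrite -rmorphB S1 rmorphM phi_cst phi_tee rmorphB !phi_lin.
Qed.

End Functoriality.

(** * Jet schemes and arc spaces *)

(** Roots and fibre coordinates are only known to exist uniquely, so the bijections are given as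
    relations; uniqueness makes the chosen maps natural and mutually inverse. *)
Lemma isomorphic_of_rel (k : fieldType) (X Y : kfunctor k)
    (rel : forall R : comAlgType k, X R -> Y R -> Prop) :
    (forall (R S : comAlgType k) (phi : {lrmorphism R -> S}) p q,
       rel R p q -> rel S (fmap phi p) (fmap phi q)) ->
    (forall R p, exists! q, rel R p q) -> (forall R q, exists! p, rel R p q) ->
  isomorphic X Y.
Proof.
move=> relN relF relG.
pose F R p := sval (cid (relF R p)); pose G R q := sval (cid (relG R q)).
have FP R p : unique (rel R p) (F R p) by rewrite /F; case: cid.
have GP R q : unique (rel R ^~ q) (G R q) by rewrite /G; case: cid.
have FN (R S : comAlgType k) (phi : {lrmorphism R -> S}) p : F S (fmap phi p) = fmap phi (F R p).
  by apply: (FP S _).2; apply/relN/(FP R p).1.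
have GN (R S : comAlgType k) (phi : {lrmorphism R -> S}) q : G S (fmap phi q) = fmap phi (G R q).
  by apply: (GP S _).2; apply/relN/(GP R q).1.
exists (Morphism FN), (Morphism GN) => R; split=> [p|q] /=.
  by apply: (GP R _).2; apply: (FP R p).1.
by apply: (FP R _).2; apply: (GP R q).1.
Qed.

Section ArcSpace.
Variable k : fieldType.

Lemma jet_trunc_trunc (X : kfunctor k) (R : comAlgType k) m1 m2 m3 (lt12 : (m1 < m2)%N)
    (lt23 : (m2 < m3)%N) (lt13 : (m1 < m3)%N) (p : jet_scheme X m3 R) :
  jet_trunc X lt12 R (jet_trunc X lt23 R p) = jet_trunc X lt13 R p.
Proof.
apply/esym; rewrite /= /jet_trunc_component; apply: fmap_comp => a; apply/truncpolyP => i le.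
by rewrite /comp !coef_truncpoly_trunc // (leq_trans le) // ltnW.
Qed.

Lemma arc_rel_fun (X Y : kfunctor k)
    (rel : forall m (R : comAlgType k), jet_scheme X m R -> jet_scheme Y m R -> Prop) :
    (forall m' m (lt : (m' < m)%N) R p q, (0 < m')%N ->
       rel m R p q -> rel m' R (jet_trunc X lt R p) (jet_trunc Y lt R q)) ->
    (forall m R p, (0 < m)%N -> exists! q, rel m R p q) ->
  forall R (p : arc_space X R), exists! q : arc_space Y R,
    forall m, (0 < m)%N -> rel m R (sval p m) (sval q m).
Proof.
move=> relT relF R [p pT] /=.
(* [Q m] is the partner at level m + 1, since partners are given at positive levels only; truncating
   it by one level gives a component for every m, including 0. *)
pose Q m := sval (cid (relF m.+1 R (p m.+1) isT)).
have QP m : unique (rel m.+1 R (p m.+1)) (Q m) by rewrite /Q; case: cid.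
have QT m' m (lt : (m'.+1 < m.+1)%N) : jet_trunc Y lt R (Q m) = Q m'.
  by apply/esym/(QP m').2; rewrite -(pT _ _ lt); apply/relT/(QP m).1.
pose q m := jet_trunc Y (ltnSn m) R (Q m).
have qT m' m (lt : (m' < m)%N) : jet_trunc Y lt R (q m) = q m'.
  have lt' : (m'.+1 < m.+1)%N by [].
  have lt'' : (m' < m.+1)%N by apply: ltnW.
  by rewrite /q (jet_trunc_trunc _ _ lt'') -(QT _ _ lt') (jet_trunc_trunc _ _ lt'').
exists (exist _ q qT); split=> [[//|m] _|[q' q'T] /= q'P].
  by rewrite /= /q QT; apply: (QP m).1.
apply: eq_exist; apply: functional_extensionality_dep => m.
by rewrite -(q'T _ _ (ltnSn m)) /q; congr (jet_trunc Y _ R _); apply/(QP m).2/q'P.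
Qed.

End ArcSpace.

(** * Coefficients and nilpotents of R[t]/(t^(m+1)) *)

Section TruncpolyJetting.
Variables (k : fieldType) (R : comAlgType k) (m : nat).
Local Notation T := (truncpoly R m).

Definition trunc_cst (r : R) : T := in_qpoly ('X^(m.+1) : {poly R}) r%:P.
Definition trunc_res (a : T) : R := (a : {poly R})`_0.
Definition trunc_lin (a : T) : R := (a : {poly R})`_1.
Definition trunc_tee : T := in_qpoly ('X^(m.+1) : {poly R}) 'X.

Lemma coef_trunc_cst r i : (i <= m)%N ->
  (trunc_cst r : {poly R})`_i = if i == 0%N then r else 0.
Proof. by move=> le; rewrite coef_in_truncpoly // coefC. Qed.

Lemma coef_trunc_cstM r (a : T) i : (i <= m)%N ->
  ((trunc_cst r * a : T) : {poly R})`_i = r * (a : {poly R})`_i.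
Proof.
move=> le; rewrite coef_truncpolyM // coefM big_ord_recl big1 ?addr0 ?subn0 => [|j _].
  by rewrite coef_trunc_cst.
by rewrite coef_trunc_cst ?mul0r // (leq_trans (ltn_ord j)).
Qed.

Fact trunc_cst_additive : zmod_morphism trunc_cst.
Proof.
move=> a b; apply/truncpolyP => i le.
by rewrite coefB !coef_trunc_cst //; case: ifP; rewrite ?subr0.
Qed.

Fact trunc_cst_monoid_morphism : monoid_morphism trunc_cst.
Proof.
split=> [|a b]; apply/truncpolyP => i le; first by rewrite coef_trunc_cst ?coef1 //; case: eqP.
by rewrite coef_trunc_cstM // !coef_trunc_cst //; case: ifP; rewrite ?mulr0.
Qed.

HB.instance Definition _ := GRing.isZmodMorphism.Build R T trunc_cst trunc_cst_additive.
HB.instance Definition _ := GRing.isMonoidMorphism.Build R T trunc_cst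
  trunc_cst_monoid_morphism.

Fact trunc_res_additive : zmod_morphism trunc_res.
Proof. by move=> a b; rewrite /trunc_res coefB. Qed.

Fact trunc_res_monoid_morphism : monoid_morphism trunc_res.
Proof.
by split=> [|a b]; rewrite /trunc_res ?coef1 // coef_truncpolyM // coef0M.
Qed.

HB.instance Definition _ := GRing.isZmodMorphism.Build T R trunc_res trunc_res_additive.
HB.instance Definition _ := GRing.isMonoidMorphism.Build T R trunc_res
  trunc_res_monoid_morphism.

Fact trunc_lin_additive : zmod_morphism trunc_lin.
Proof. by move=> a b; rewrite /trunc_lin coefB. Qed.

HB.instance Definition _ := GRing.isZmodMorphism.Build T R trunc_lin trunc_lin_additive.

Lemma trunc_cstK : cancel trunc_cst trunc_res.
Proof. by move=> r; rewrite /trunc_res coef_trunc_cst. Qed.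

Lemma trunc_res_tee : trunc_res trunc_tee = 0.
Proof. by rewrite /trunc_res coef_in_truncpoly // coefX. Qed.

Lemma trunc_lin_tee (gt0 : (0 < m)%N) d : trunc_lin (trunc_cst d * trunc_tee) = d.
Proof. by rewrite /trunc_lin coef_trunc_cstM // coef_in_truncpoly // coefX mulr1. Qed.

Lemma trunc_res_nilp (a : T) : trunc_res a = 0 -> exists n, a ^+ n = 0.
Proof.
have dropE (p : {poly R}) : p`_0 = 0 -> p = drop_poly 1 p * 'X.
  move=> p0; rewrite -['X]expr1 -[LHS](poly_take_drop 1) [take_poly _ _](_ : _ = 0) ?add0r //.
  by apply/polyP => -[|i]; rewrite coef_take_poly coef0.
move=> /dropE aE; exists m.+1.
have aX n i : (i <= m)%N -> ((a ^+ n : T) : {poly R})`_i = ((a : {poly R}) ^+ n)`_i.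
  elim: n i => [|n IH] i le; first by rewrite !expr0.
  rewrite (exprS a) (exprS (a : {poly R})) coef_truncpolyM // !coefM; apply: eq_bigr => j _.
  by rewrite IH // (leq_trans (leq_subr _ _)).
apply/truncpolyP => i le; rewrite aX //; move: (a : {poly R}) aE => p ->.
by rewrite exprMn coefMXn ltnS le coef0.
Qed.

Definition trunc_jetting (gt0 : (0 < m)%N) : jetting R T :=
  Jetting trunc_cstK trunc_res_tee (trunc_lin_tee gt0) trunc_res_nilp.

End TruncpolyJetting.

Section Points.
Variables (k : fieldType) (n : nat) (A : comAlgType k).
Implicit Types p q : hypersurface (danielewski k n) A.

Lemma point_eq p : val p i0 ^+ n * val p i2 = val p i1 ^+ 2 - 1.
Proof.
have /eqP := valP p; rewrite mmap_danielewski => E.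
by apply: (lincomb1 1 E); ring.
Qed.

Lemma point_exists x y z : x ^+ n * z = y ^+ 2 - 1 ->
  exists p, [/\ val p i0 = x, val p i1 = y & val p i2 = z].
Proof.
move=> E; have P : mmap (in_alg A) (triple x y z) (danielewski k n) == 0.
  by rewrite mmap_danielewski !ffunE /tnth /= E addrAC subrK subrr.
pose p : hypersurface (danielewski k n) A := exist _ (triple x y z) P.
by exists p; rewrite !ffunE.
Qed.

Lemma point_inj p q : val p i0 = val q i0 -> val p i1 = val q i1 ->
  val p i2 = val q i2 -> p = q.
Proof. by move=> e0 e1 e2; apply/val_inj/ffunP; apply: ord3P. Qed.

End Points.

Section Jets.
Variable k : fieldType.
Hypothesis two_neq0 : 2%:R != 0 :> k.
Local Notation X := (hypersurface (danielewski k 1)).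
Local Notation Y := (hypersurface (danielewski k 2)).

Definition half (R : comAlgType k) : R := (2%:R^-1)%:A.

Lemma half2 R : half R * 2%:R = 1.
Proof.
by rewrite /half mulr_algl -scaler_nat scalerA mulVf ?scale1r.
Qed.

(** With positivity inside the relation, it is defined for all m, and empty for m = 0; [arc_rel_fun]
    takes such a family. *)
Definition surface_jet_rel m (R : comAlgType k) (p : X (truncpoly R m))
    (q : Y (truncpoly R m)) :=
  val q i0 = val p i0 /\ exists gt0 : (0 < m)%N,
    jet_rel (trunc_jetting R gt0) (half R)
      (val p i0) (val p i1) (val p i2) (val q i1) (val q i2).

(** Handles base change (m' = m) and truncation ([phi0] the identity) at once, as both act
    coefficient by coefficient. *)
Lemma surface_jet_rel_morph m m' (R S : comAlgType k) (phi0 : {lrmorphism R -> S})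
    (phi : {lrmorphism truncpoly R m -> truncpoly S m'}) p q : (0 < m' <= m)%N ->
    (forall a i, (i <= m')%N -> (phi a : {poly S})`_i = phi0 (a : {poly R})`_i) ->
  surface_jet_rel p q -> surface_jet_rel (fmap phi p) (fmap phi q).
Proof.
move=> /andP[gt0' le'] phiE [e [gt0 rel]]; split; first by rewrite /= !ffunE e.
exists gt0'; rewrite /= !ffunE.
have -> : half S = phi0 (half R) by rewrite linearZ rmorph1.
apply: jet_rel_morph rel => [r|a|a|]; [|exact: phiE|exact: phiE|].
  apply/truncpolyP => i le; rewrite phiE // !coef_trunc_cst ?(leq_trans le) //.
  by case: ifP; rewrite ?rmorph0.
apply/truncpolyP => i le; rewrite phiE // !coef_in_truncpoly ?(leq_trans le) //.
by rewrite !coefX rmorph_nat.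
Qed.

Lemma surface_jet_rel_fun m R p : (0 < m)%N -> exists! q, @surface_jet_rel m R p q.
Proof.
move=> gt0; have Ep := point_eq p; rewrite expr1 in Ep.
have [y' [z' rel]] := jet_rel_total (trunc_jetting R gt0) (half2 R) Ep.
have [_ /point_exists[q [q0 q1 q2]]] := jet_rel_eq rel.
exists q; split=> [|q' [e' [gt0' rel']]].
  by split=> //; exists gt0; rewrite q1 q2.
rewrite (bool_irrelevance gt0' gt0) in rel'.
have [e1 e2] := jet_rel_fun (half2 R) rel rel'.
by apply: point_inj; rewrite ?q0 ?q1 ?q2.
Qed.

Lemma surface_jet_rel_inj m R q : (0 < m)%N -> exists! p, @surface_jet_rel m R p q.
Proof.
move=> gt0; have Eq := point_eq q.
have [y [z rel]] := jet_rel_surj (trunc_jetting R gt0) (half2 R) Eq.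
have [/(@point_exists k 1)[p [p0 p1 p2]] _] := jet_rel_eq rel.
exists p; split=> [|p' [e' [gt0' rel']]].
  by split=> //; exists gt0; rewrite p0 p1 p2.
rewrite (bool_irrelevance gt0' gt0) -e' in rel'.
have [e1 e2] := jet_rel_inj (half2 R) rel rel'.
by apply: point_inj; rewrite ?p0 ?p1 ?p2.
Qed.

Lemma jet_scheme_isomorphic m : (0 < m)%N -> isomorphic (jet_scheme X m) (jet_scheme Y m).
Proof.
move=> gt0; apply: (@isomorphic_of_rel k (jet_scheme X m) (jet_scheme Y m)
  (@surface_jet_rel m)).
- move=> R S phi p q; apply: (surface_jet_rel_morph (phi0 := phi)); rewrite ?gt0 ?leqnn // => a i le.
  exact: coef_truncpoly_map.
- by move=> R p; apply: surface_jet_rel_fun.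
by move=> R q; apply: surface_jet_rel_inj.
Qed.

Lemma arc_space_isomorphic : isomorphic (arc_space X) (arc_space Y).
Proof.
have relT m' m (lt : (m' < m)%N) (R : comAlgType k) p q : (0 < m')%N ->
    @surface_jet_rel m R p q ->
    surface_jet_rel (jet_trunc X lt R p) (jet_trunc Y lt R q).
  move=> gt0; apply: (surface_jet_rel_morph (phi0 := idfun)); rewrite ?gt0 ?(ltnW lt) // => a i le.
  exact: coef_truncpoly_trunc.
apply: (@isomorphic_of_rel k (arc_space X) (arc_space Y) (fun R p q =>
    forall m, (0 < m)%N -> @surface_jet_rel m R (sval p m) (sval q m))).
- move=> R S phi p q pq m gt0 /=.
  apply: (surface_jet_rel_morph (phi0 := phi)) (pq m gt0); rewrite ?gt0 ?leqnn // => a i le.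
  exact: coef_truncpoly_map.
- apply: (@arc_rel_fun k X Y (@surface_jet_rel)) => // m R p.
  exact: surface_jet_rel_fun.
apply: (@arc_rel_fun k Y X (fun m R q p => @surface_jet_rel m R p q)).
  by move=> m' m lt R q p; apply: relT.
by move=> m R q; apply: surface_jet_rel_inj.
Qed.

End Jets.

(* m = 0 is excluded: the 0-jet scheme of X is X itself. *)
Theorem theorem3p4 (R : realType) :
  let C : fieldType := complex R in
  let X := hypersurface (varx * varz - vary ^+ 2 + 1 : {mpoly C[3]}) in
  let Y := hypersurface (varx ^+ 2 * varz - vary ^+ 2 + 1 : {mpoly C[3]}) in
  ~ isomorphic X Y /\
  (forall m : nat, (0 < m)%N -> isomorphic (jet_scheme X m) (jet_scheme Y m)) /\
  isomorphic (arc_space X) (arc_space Y).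
Proof.
move=> C X Y.
have natr0 n : (n%:R == 0 :> C) = (n == 0)%N by rewrite Num.Theory.pnatr_eq0.
(* [varx ^+ 1] computes to [varx], so X and Y are the surfaces of [danielewski C 1] and
   [danielewski C 2]. *)
split; first exact: (not_isomorphic_danielewski natr0).
split=> [m gt0|]; last by apply: arc_space_isomorphic; rewrite natr0.
by apply: jet_scheme_isomorphic => //; rewrite natr0.
Qed.
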